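(* Let $\mathbf{V}_{\mathbb{C}}^{3}$ be the three-dimensional space of complex vectors equipped with the componentwise geometric product $\star$ (written by juxtaposition). Then: 1. the geometric product is bilinear; 2. the geometric product is commutative; 3. the geometric product is associative; 4. the complex vector $(\mathbf{1}_{\mathbf{V}},i\mathbf{0})\in\mathbf{V}_{\mathbb{C}}^{3}$, where $\mathbf{1}_{\mathbf{V}}=\mathbf{e}_{\alpha}\mathbf{e}^{\alpha}$, is the multiplicative identity of the geometric product, i.e. $\mathbf{1}_{\mathbf{V}}\mathbf{a}=\mathbf{a}\mathbf{1}_{\mathbf{V}}=\mathbf{a}$ for all $\mathbf{a}\in\mathbf{V}_{\mathbb{C}}^{3}$; 5. every nonzero vector $\mathbf{a}\in\mathbf{V}_{\mathbb{C}}^{3}$ admits a unique inverse, given by $\mathbf{a}^{-1}=\mathbf{a}_{\alpha}^{-1}\mathbf{e}^{\alpha}$ with $\mathbf{a}_{\alpha}^{-1}=\bar{\mathbf{a}}_{\alpha}/\|\mathbf{a}_{\alpha}\|^{2}$, satisfying $\mathbf{a}^{-1}\mathbf{a}=\mathbf{a}\mathbf{a}^{-1}=\mathbf{1}_{\mathbf{V}}$.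
   Context: **The 2D field $\mathbf{V}_{\mathbb{C}}$.** $\mathbf{V}_{\mathbb{C}}$ is a two-dimensional real vector space with basis $(\mathbf{e},\hat{\mathbf{e}})$. The vector $x\mathbf{e}+y\hat{\mathbf{e}}$ ($x,y\in\mathbb{R}$) stands for the ordered pair of the real vector $x\mathbf{1}_x$ and the purely imaginary vector $iy\mathbf{1}_y$. The conjugate of $\boldsymbol{\varrho}=x\mathbf{e}+y\hat{\mathbf{e}}$ is $\bar{\boldsymbol{\varrho}}=x\mathbf{e}-y\hat{\mathbf{e}}$, and $\|\boldsymbol{\varrho}\|=\sqrt{x^2+y^2}$. For $\boldsymbol{\varrho}_k=x_k\mathbf{e}+y_k\hat{\mathbf{e}}$ ($k=1,2$), the inner and outer vector products are $$\boldsymbol{\varrho}_1\circ\boldsymbol{\varrho}_2=(x_1x_2+y_1y_2)\mathbf{e},\qquad \boldsymbol{\varrho}_1\wedge\boldsymbol{\varrho}_2=(x_1y_2-y_1x_2)\hat{\mathbf{e}}.$$ The geometric product $\star$ on $\mathbf{V}_{\mathbb{C}}$, written by juxtaposition, is defined by $\bar{\boldsymbol{\varrho}}_1\star\boldsymbol{\varrho}_2=\boldsymbol{\varrho}_1\circ\boldsymbol{\varrho}_2+\boldsymbol{\varrho}_1\wedge\boldsymbol{\varrho}_2$ for all $\boldsymbol{\varrho}_1,\boldsymbol{\varrho}_2$. (So $(x_1\mathbf{e}+y_1\hat{\mathbf{e}})\star(x_2\mathbf{e}+y_2\hat{\mathbf{e}})=(x_1x_2-y_1y_2)\mathbf{e}+(x_1y_2+y_1x_2)\hat{\mathbf{e}}$.)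 **The 3D space $\mathbf{V}_{\mathbb{C}}^{3}$.** $\mathbf{V}_{\mathbb{C}}^{3}$ is the direct sum of three mutually orthogonal copies $\langle\mathbf{V}_{\mathbb{C}}\rangle_{\alpha}$, $\alpha=1,2,3$, of $\mathbf{V}_{\mathbb{C}}$, with bases $(\mathbf{e}_\alpha,\hat{\mathbf{e}}_\alpha)$. A vector is written $\mathbf{a}=\mathbf{a}_\alpha\mathbf{e}^\alpha$ (summation over the repeated index $\alpha$), where $\mathbf{a}_\alpha=\langle a\mathbf{e}+\hat a\hat{\mathbf{e}}\rangle_\alpha\in\langle\mathbf{V}_{\mathbb{C}}\rangle_\alpha$ is its $\alpha$-th component; that is, $\mathbf{a}$ is the element of the direct sum with components $\mathbf{a}_1,\mathbf{a}_2,\mathbf{a}_3$. In particular $\mathbf{1}_{\mathbf{V}}=\mathbf{e}_\alpha\mathbf{e}^\alpha$ is the vector all of whose components equal the unit $\mathbf{e}_\alpha$ of $\langle\mathbf{V}_{\mathbb{C}}\rangle_\alpha$. Conjugation is componentwise, $\bar{\mathbf{a}}=\bar{\mathbf{a}}_\alpha\mathbf{e}^\alpha$. The geometric product is defined componentwise: $\bar{\mathbf{a}}\mathbf{b}=\langle\mathbf{a}\circ\mathbf{b}+\mathbf{a}\wedge\mathbf{b}\rangle_\alpha\mathbf{e}^\alpha=\langle\bar{\mathbf{a}}\mathbf{b}\rangle_\alpha\mathbf{e}^\alpha$, where $\langle\cdot\rangle_\alpha$ means that the operation is performed on the $\alpha$-th components in $\langle\mathbf{V}_{\mathbb{C}}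\rangle_\alpha$.
   Formalization: In item 5, ''every nonzero vector'' is replaced by ''every vector all of whose components are nonzero'': a nonzero vector with a vanishing component, such as (e_1, 0, 0), has no inverse, and the stated formula would divide by zero there. *)

(* Defs.v *)
From mathcomp Require Import all_boot all_order all_algebra.
From mathcomp Require Import reals.

Set Implicit Arguments.
Unset Strict Implicit.
Unset Printing Implicit Defensive.

Import GRing.Theory Num.Theory.

Local Open Scope ring_scope.

(* The vector x e + y ehat is the row (x, y). *)
Notation VC R := ('rV[R]_2).

Section PlaneField.
Variable R : realType.
Implicit Types u v : VC R.

Definition e : VC R := delta_mx 0 0.
Definition ehat : VC R := delta_mx 0 1.

Definition xcoord u : R := u 0 0.
Definition ycoord u : R := u 0 1.

Definition conjVC u : VC R := xcoord u *: e - ycoord u *: ehat.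

Definition normVC u : R := Num.sqrt (xcoord u ^+ 2 + ycoord u ^+ 2).

Definition inner u v : VC R :=
  (xcoord u * xcoord v + ycoord u * ycoord v) *: e.

Definition outer u v : VC R :=
  (xcoord u * ycoord v - ycoord u * xcoord v) *: ehat.

(* The product is specified by conj(u) * v = inner u v + outer u v for all
   u and v; as conjugation is an involution, this determines u * v. *)
Definition mulVC u v : VC R := inner (conjVC u) v + outer (conjVC u) v.

End PlaneField.

Arguments e {R}.
Arguments ehat {R}.

(* Direct sum of three copies of VC R: a alpha is the alpha-th component. *)
Notation VC3 R := ({ffun 'I_3 -> VC R}).

Section Space.
Variable R : realType.
Implicit Types a b : VC3 R.

(* The complex vector (p, i q), with real part p and imaginary part i q. *)
Definition complex_vector (p q : 'rV[R]_3) : VC3 R :=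
  [ffun alpha => p 0 alpha *: e + q 0 alpha *: ehat].

Definition gprod a b : VC3 R := [ffun alpha => mulVC (a alpha) (b alpha)].

Definition oneV : VC3 R := [ffun=> e].

(* An inverse only when no component of a vanishes: otherwise the vanishing
   components are sent to 0, division by 0 being total. *)
Definition invV a : VC3 R :=
  [ffun alpha => (normVC (a alpha) ^+ 2)^-1 *: conjVC (a alpha)].

Definition is_inverse a b : Prop := gprod b a = oneV /\ gprod a b = oneV.

End Space.

Arguments oneV {R}.

(* Main.v *)
Require Import Defs.
From mathcomp Require Import all_boot all_order all_algebra.
From mathcomp Require Import reals.
From mathcomp Require Import ring.

Import GRing.Theory Num.Theory.
Local Open Scope ring_scope.

(** In the coordinates (x, y) the product of the plane is multiplication of
    the complex numbers x + i y: the conjugation built into [mulVC] turns the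
    inner and outer products into the real and imaginary parts [xcoord_mul]
    and [ycoord_mul].  Each algebraic law of the plane is then a polynomial
    identity in the coordinates.  Since the product of the space acts
    separately on the three components, the laws of the plane lift to it.

    Invertibility comes from the fact that a nonzero u has
    x ^+ 2 + y ^+ 2 != 0 over an ordered field, so that conj u / |u| ^+ 2 is
    inverse to u.  In the space, this applies as soon as every component is
    nonzero.  Uniqueness is the usual consequence of associativity and
    commutativity: two inverses b and c of a satisfy b = b (a c) = (b a) c = c. *)

Section Plane.
Variable R : realType.
Implicit Types (u v w : VC R) (k : R).

Lemma eq_coordVC u v : xcoord u = xcoord v -> ycoord u = ycoord v -> u = v.
Proof.
move=> ex ey; apply/rowP=> j.
have [-> | ->] : j = 0 \/ j = 1.
- by case: j => [[|[|]]] //= ?; [left | right]; apply: val_inj.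
- exact: ex.
- exact: ey.
Qed.

Lemma xcoordD u v : xcoord (u + v) = xcoord u + xcoord v.
Proof. exact: mxE. Qed.

Lemma ycoordD u v : ycoord (u + v) = ycoord u + ycoord v.
Proof. exact: mxE. Qed.

Lemma xcoordZ k u : xcoord (k *: u) = k * xcoord u.
Proof. exact: mxE. Qed.

Lemma ycoordZ k u : ycoord (k *: u) = k * ycoord u.
Proof. exact: mxE. Qed.

Lemma xcoord_e : xcoord (e : VC R) = 1.
Proof. by rewrite /xcoord mxE. Qed.

Lemma ycoord_e : ycoord (e : VC R) = 0.
Proof. by rewrite /ycoord mxE. Qed.

Lemma xcoord_ehat : xcoord (ehat : VC R) = 0.
Proof. by rewrite /xcoord mxE. Qed.

Lemma ycoord_ehat : ycoord (ehat : VC R) = 1.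
Proof. by rewrite /ycoord mxE. Qed.

Let basisE := (xcoordD, ycoordD, xcoordZ, ycoordZ,
               xcoord_e, ycoord_e, xcoord_ehat, ycoord_ehat).

Lemma xcoord_conj u : xcoord (conjVC u) = xcoord u.
Proof. by rewrite /conjVC -scaleNr !basisE; ring. Qed.

Lemma ycoord_conj u : ycoord (conjVC u) = - ycoord u.
Proof. by rewrite /conjVC -scaleNr !basisE; ring. Qed.

(** [mulVC] conjugates its first factor before taking the inner and outer
    products, which flips both signs: the dot product gets its minus sign
    here, and the cross product its plus sign in [ycoord_mul]. *)
Lemma xcoord_mul u v :
  xcoord (mulVC u v) = xcoord u * xcoord v - ycoord u * ycoord v.
Proof.
by rewrite /mulVC /inner /outer !(xcoord_conj, ycoord_conj, basisE); ring.
Qed.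

Lemma ycoord_mul u v :
  ycoord (mulVC u v) = xcoord u * ycoord v + ycoord u * xcoord v.
Proof.
by rewrite /mulVC /inner /outer !(xcoord_conj, ycoord_conj, basisE); ring.
Qed.

(* The order matters: the sums hidden in [mulVC] and [conjVC] would also match
   [xcoordD] and [ycoordD] up to unfolding. *)
Let coordE := (xcoord_mul, ycoord_mul, xcoord_conj, ycoord_conj, basisE).

Lemma mulVC_comm : commutative (@mulVC R).
Proof. by move=> u v; apply: eq_coordVC; rewrite !coordE; ring. Qed.

Lemma mulVC_assoc : associative (@mulVC R).
Proof. by move=> u v w; apply: eq_coordVC; rewrite !coordE; ring. Qed.

Lemma mul1VC : left_id e (@mulVC R).
Proof. by move=> u; apply: eq_coordVC; rewrite !coordE; ring. Qed.

Lemma mulVC_linearl k u v w :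
  mulVC (k *: u + v) w = k *: mulVC u w + mulVC v w.
Proof. by apply: eq_coordVC; rewrite !coordE; ring. Qed.

Lemma sqr_normVC u : normVC u ^+ 2 = xcoord u ^+ 2 + ycoord u ^+ 2.
Proof. by rewrite sqr_sqrtr // addr_ge0 ?sqr_ge0. Qed.

(** A sum of two squares in an ordered field vanishes only if both do. *)
Lemma sqr_normVC_neq0 u : u != 0 -> normVC u ^+ 2 != 0.
Proof.
apply: contra_neq; rewrite sqr_normVC => /eqP.
rewrite paddr_eq0 ?sqr_ge0 // !sqrf_eq0 => /andP[/eqP x0 /eqP y0].
by apply: eq_coordVC; rewrite ?x0 ?y0 [RHS]mxE.
Qed.

(** The identity conj u * u = |u| ^+ 2 e, divided by |u| ^+ 2. *)
Lemma mulVVC u : u != 0 -> mulVC ((normVC u ^+ 2)^-1 *: conjVC u) u = e.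
Proof.
move=> /sqr_normVC_neq0; rewrite sqr_normVC => n0.
by apply: eq_coordVC; rewrite !coordE; field.
Qed.

End Plane.

Section ComponentwiseProduct.
Variable R : realType.
Implicit Types (a b c : VC3 R) (k : R).

Lemma gprodC : commutative (@gprod R).
Proof. by move=> a b; apply/ffunP=> i; rewrite !ffunE mulVC_comm. Qed.

Lemma gprodA : associative (@gprod R).
Proof. by move=> a b c; apply/ffunP=> i; rewrite !ffunE mulVC_assoc. Qed.

Lemma gprod1V : left_id oneV (@gprod R).
Proof. by move=> a; apply/ffunP=> i; rewrite !ffunE mul1VC. Qed.

Lemma gprod_linearl k a b c :
  gprod (k *: a + b) c = k *: gprod a c + gprod b c.
Proof. by apply/ffunP=> i; rewrite !ffunE mulVC_linearl. Qed.

Lemma gprod_bilinear : bilinear_for *:%R *:%R (@gprod R).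
Proof.
split=> c k a b /=; first exact: gprod_linearl.
by rewrite ![gprod c _]gprodC gprod_linearl.
Qed.

Lemma complex_vector_1_0 : complex_vector (const_mx 1) 0 = oneV :> VC3 R.
Proof. by apply/ffunP=> i; rewrite !ffunE !mxE scale1r scale0r addr0. Qed.

Lemma gprodVV a : (forall i, a i != 0) -> gprod (invV a) a = oneV.
Proof. by move=> a0; apply/ffunP=> i; rewrite !ffunE mulVVC. Qed.

Lemma is_inverse_uniq a b c : is_inverse a b -> is_inverse a c -> b = c.
Proof.
by move=> [ba _] [_ ac]; rewrite -[b]gprod1V gprodC -ac gprodA ba gprod1V.
Qed.

End ComponentwiseProduct.

Theorem theorem1 (R : realType) :
  [/\ bilinear_for *:%R *:%R (@gprod R),
      commutative (@gprod R),
      associative (@gprod R),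
      complex_vector (const_mx 1) 0 = oneV :> VC3 R /\
        (forall a : VC3 R, gprod oneV a = a /\ gprod a oneV = a)
    & forall a : VC3 R, (forall alpha : 'I_3, a alpha != 0) ->
        unique (is_inverse a) (invV a)].
Proof.
split.
- exact: gprod_bilinear.
- exact: gprodC.
- exact: gprodA.
- split=> [|a]; first exact: complex_vector_1_0.
  by rewrite [gprod a _]gprodC gprod1V.
- move=> a a0.
  have inv_a : is_inverse a (invV a) by split; [|rewrite gprodC]; exact: gprodVV.
  by split=> // b; apply: is_inverse_uniq.
Qed.
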